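(* For all integers $d\ge 0$ and $n\ge 1$, the map $\phi$ is a bijection between $\mathcal{S}^d_n$ (the difference $d$ permutations of $[n]$) and $\mathcal{A}^d_n$ (the $d$-ascent sequences of length $n$). Furthermore, $\mathrm{act}(\pi)=\mathrm{dasc}(\phi(\pi))+1$ for all $\pi\in\mathcal{S}^d_n$.
   Context: Fix an integer $d\ge 0$. $[n]=\{1,\dots,n\}$ and $\mathcal{S}_n$ is the set of permutations of $[n]$, written as words $\pi=\pi_1\cdots\pi_n$. $d$-ascent sequences: for an integer sequence $x=x_1\cdots x_n$, an index $i$ ($1\le i\le n-1$) is a $d$-ascent of $x$ if $x_{i+1}>x_i-d$; $\mathrm{dasc}(x)$ is the number of $d$-ascents of $x$. The sequence $x$ is a $d$-ascent sequence if $x_1=0$ and $0\le x_i\le \mathrm{dasc}(x_1\cdots x_{i-1})+1$ for all $2\le i\le n$. $\mathcal{A}^d_n$ is the set of $d$-ascent sequences of length $n$. Active elements: for $\pi\in\mathcal{S}_n$, the elements $1,\dots,n$ are declared ($d$-)active or inactive in increasing order. The element $1$ is active. For $k=2,\dots,n$, the element $k$ is inactive if $k$ is to the left of $k-1$ in $\pi$ and at least $d$ active elements smaller than $k-1$ lie (in position) between $k$ and $k-1$ in $\pi$; otherwise $k$ is active. $\mathrm{Act}(\pi)$ is the set of active elements of $\pi$ and $\mathrm{act}(\pi)=|\mathrm{Act}(\pi)|$. Difference $d$ permutations: $\mathrm{Ascbot}(\pi)=\{\pi_i : 1\le i\le n-1,\ \pi_i<\pi_{i+1}\}$. A permutation $\pi$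 is a difference $d$ permutation if $\mathrm{Ascbot}(\pi)\subseteq \mathrm{Act}(\pi)$. $\mathcal{S}^d_n$ is the set of difference $d$ permutations in $\mathcal{S}_n$. The map $\phi$ is defined recursively on $\mathcal{S}^d_n$: for $n=1$, $\phi(1)=0$. For $n\ge 2$ and $\pi\in \mathcal{S}^d_n$, let $\sigma$ be obtained from $\pi$ by deleting $n$; then $\sigma\in\mathcal{S}^d_{n-1}$, and in $\pi$ the element $n$ is either in first position or immediately to the right of some active element of $\sigma$. Put $x_n=0$ if $n$ is in first position, and otherwise let $x_n$ be such that $n$ is immediately after the $x_n$-th active element of $\sigma$ (reading active elements from left to right). Then $\phi(\pi)=x_1\cdots x_{n-1}x_n$, where $x_1\cdots x_{n-1}=\phi(\sigma)$. *)

(* Defs.v *)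
From mathcomp Require Import all_boot all_order all_algebra.

Set Implicit Arguments.
Unset Strict Implicit.
Unset Printing Implicit Defensive.

Import Order.TTheory GRing.Theory Num.Theory.

(* Words are 0-indexed: pi_i is [nth 0 p i.-1] and x_i is the (i.-1)-th entry
   of x. *)

Definition is_dascent (d : nat) (x : seq int) (i : nat) : bool :=
  (x`_i.+1 > x`_i - d%:Z)%R.

Definition dasc (d : nat) (x : seq int) : nat :=
  count (is_dascent d x) (iota 0 (size x).-1).

Definition dascent_seq (d n : nat) (x : seq int) : bool :=
  [&& size x == n, (x`_0 == 0)%R
    & all (fun i => (0 <= x`_i <= (dasc d (take i x))%:Z + 1)%R)
          (iota 1 n.-1)].

Definition perm_word (n : nat) (p : seq nat) : bool := perm_eq p (iota 1 n).

(* Here A is meant to be the list of active elements smaller than k. *)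
Definition inactive (d : nat) (p A : seq nat) (k : nat) : bool :=
  (index k p < index k.-1 p) &&
  (d <= count (fun a => (a < k.-1) &&
                        (index k p < index a p < index k.-1 p)) A).

(* The active elements among 1, ..., k, in increasing order of value. *)
Fixpoint active_upto (d : nat) (p : seq nat) (k : nat) : seq nat :=
  match k with
  | 0 => [::]
  | 1 => [:: 1]
  | k'.+1 =>
      let A := active_upto d p k' in
      if inactive d p A k then A else rcons A k
  end.

Definition Act (d : nat) (p : seq nat) : seq nat := active_upto d p (size p).

Definition act (d : nat) (p : seq nat) : nat := size (Act d p).

Definition Ascbot (p : seq nat) : seq nat :=
  [seq nth 0 p i | i <- iota 0 (size p).-1 & nth 0 p i < nth 0 p i.+1].

Definition diff_perm (d n : nat) (p : seq nat) : bool :=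
  perm_word n p && all (fun a => a \in Act d p) (Ascbot p).

(* Here s is p with its largest letter n deleted. The letter of p just before n
   is active in s whenever p is a difference d permutation, so [index] returns
   its genuine rank among the active letters of s, read from left to right. *)
Definition insertion_label (d n : nat) (p s : seq nat) : nat :=
  let i := index n p in
  if i == 0 then 0
  else (index (nth 0 p i.-1) [seq a <- s | a \in Act d s]).+1.

Fixpoint phi_rec (d n : nat) (p : seq nat) : seq int :=
  match n with
  | 0 => [::]
  | 1 => [:: 0%R]
  | n'.+1 =>
      let s := rem n p in
      rcons (phi_rec d n' s) (Posz (insertion_label d n p s))
  end.

Definition phi (d : nat) (p : seq nat) : seq int := phi_rec d (size p) p.

(* Main.v *)
(** Inserting n into a word s on [n-1] creates at most one new ascent bottom,
    the letter just before n, and does not change which letters below n are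
    active. Hence the difference d permutations of [n] are exactly the words
    obtained from those of [n-1] by inserting n in first position or just after
    an active letter, and such an insertion is determined by its label, which
    is the number of active letters to the left of n and takes every value from
    0 to act(s). Comparing the labels of n-1 and n shows that n is active
    exactly when n-1 is a d-ascent of the label sequence, so act grows along
    with dasc, and the bound on labels is the one defining d-ascent sequences. *)

Require Import Defs.
From mathcomp Require Import all_boot all_order all_algebra.
From mathcomp Require Import zify.

Set Implicit Arguments.
Unset Strict Implicit.
Unset Printing Implicit Defensive.

(** * Cutting a word at a letter or after a marked letter *)

Lemma cat_cons_inj (T : eqType) (x : T) (u v u' v' : seq T) :
  x \notin u -> x \notin u' -> u ++ x :: v = u' ++ x :: v' -> u = u' /\ v = v'.
Proof.
move=> xu xu' E.
have Es : size u = size u'.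
  have := congr1 (index x) E.
  by rewrite !index_cat (negPf xu) (negPf xu') /= eqxx !addn0.
by move/eqP: E; rewrite eqseq_cat // eqseq_cons eqxx => /andP[/eqP-> /eqP->].
Qed.

(** The admissible insertion slots: a new largest letter may go between [u] and the rest of the word
    when this holds for the active letters. *)
Definition ends_in (A : pred nat) (u : seq nat) : bool := nilp u || A (last 0 u).

(** If one prefix were strictly longer, its extra letters would end in a letter of [A] and so raise
    its count. *)
Lemma ends_in_eq_count (A : pred nat) (u v u' v' : seq nat) :
  ends_in A u -> ends_in A u' -> u ++ v = u' ++ v' -> count A u = count A u' ->
  u = u' /\ v = v'.
Proof.
wlog le_uu' : u v u' v' / size u <= size u'.
  move=> H Au Au' E Ec; case: (leqP (size u) (size u')) => [|/ltnW] le.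
    exact: H.
  by case: (H u' v' u v le Au' Au (esym E) (esym Ec)).
move=> _ Au' E Ec.
have Eu : u' = u ++ drop (size u) u'.
  rewrite -{1}(cat_take_drop (size u) u'); congr (_ ++ _).
  have := congr1 (take (size u)) E.
  by rewrite take_size_cat // takel_cat.
move: Eu Au' Ec E; case/lastP: (drop _ _) => [|w a] ->.
  by rewrite cats0 => _ _ /eqP; rewrite eqseq_cat // eqxx => /eqP->.
rewrite /ends_in /nilp size_cat size_rcons addnS /= last_cat last_rcons => Aa.
by rewrite count_cat -cats1 count_cat /= Aa; lia.
Qed.

Lemma ends_in_exists (A : pred nat) (s : seq nat) (x : nat) :
  x <= count A s ->
  exists u v, [/\ s = u ++ v, count A u = x & ends_in A u].
Proof.
elim: s x => [|c s IH] [|x] //=.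
- by exists [::], [::].
- by exists [::], (c :: s).
case Ac: (A c) => /= le.
  have [|u [v [-> Eu Au]]] := IH x; first by lia.
  exists (c :: u), v; split=> //=; first by rewrite Ac Eu.
  by move: Au; rewrite /ends_in /=; case: u Eu.
have [|u [v [-> Eu Au]]] := IH x.+1; first by lia.
exists (c :: u), v; split=> //=; first by rewrite Ac Eu.
(* The count [x.+1] forces [u] to be nonempty, so prepending [c] keeps its last letter. *)
by move: Au; rewrite /ends_in /=; case: u Eu.
Qed.

(** As a condition on adjacent pairs, the ascent bottom requirement can be split along
    concatenations. *)
Lemma all_Ascbot (A : pred nat) (p : seq nat) :
  all A (Ascbot p) = sorted (fun a b => (a < b) ==> A a) p.
Proof.
case: p => [|a p] //; elim: p a => [|b p IH] a //=.
have := IH b; rewrite /Ascbot /= (iotaDl 1 0) filter_map.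
by case: (a < b) => /= <-; rewrite -map_comp.
Qed.

(** * Active letters when a larger letter is inserted *)

Lemma index_ltn_insert (T : eqType) (m a b : T) (u v : seq T) :
  a != m -> b != m ->
  (index a (u ++ m :: v) < index b (u ++ m :: v)) =
  (index a (u ++ v) < index b (u ++ v)).
Proof.
move=> am bm; rewrite !index_cat /= ![m == _]eq_sym (negPf am) (negPf bm).
have := index_mem a u; have := index_mem b u.
by case: (a \in u); case: (b \in u) => *; lia.
Qed.

Lemma active_uptoSS d p k : active_upto d p k.+2 =
  if inactive d p (active_upto d p k.+1) k.+2 then active_upto d p k.+1
  else rcons (active_upto d p k.+1) k.+2.
Proof. by []. Qed.

Lemma mem_active_upto_range {d p k a} :
  a \in active_upto d p k -> 0 < a <= k.
Proof.
elim: k => [|[|k] IH] //; first by rewrite inE => /eqP->.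
have H : a \in active_upto d p k.+1 -> 0 < a <= k.+2 by move/IH; lia.
rewrite active_uptoSS; case: ifP => _ //.
by rewrite mem_rcons inE => /orP[/eqP->|] //=.
Qed.

Lemma active_upto_uniq d p k : uniq (active_upto d p k).
Proof.
elim: k => [|[|k] IH] //; rewrite active_uptoSS; case: ifP => _ //.
rewrite rcons_uniq IH andbT; apply/negP => /mem_active_upto_range; lia.
Qed.

Lemma mem_active_upto_recr d p k a :
  a <= k -> (a \in active_upto d p k.+1) = (a \in active_upto d p k).
Proof.
case: k => [|k] ak; first by rewrite inE; case: a ak.
rewrite active_uptoSS; case: ifP => _ //; rewrite mem_rcons inE; case: eqP => // ?; lia.
Qed.

(** Activity up to [k] depends only on the relative positions of letters at most [k], which a larger
    letter [m] leaves unchanged. *)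
Lemma active_upto_insert d u v m k :
  k < m -> active_upto d (u ++ m :: v) k = active_upto d (u ++ v) k.
Proof.
elim: k => [|[|k] IH] // km.
rewrite !active_uptoSS IH; last by lia.
set A := active_upto _ _ _.
suff -> : inactive d (u ++ m :: v) A k.+2 = inactive d (u ++ v) A k.+2 by [].
rewrite /inactive /= index_ltn_insert; [|lia..].
congr (_ && (_ <= _)); apply: eq_count => a.
case: ltnP => //= ak; rewrite !index_ltn_insert //; lia.
Qed.

(** * Permutation words split at their largest letter *)

Lemma perm_word_insert n u v :
  perm_word n.+1 (u ++ n.+1 :: v) = perm_word n (u ++ v).
Proof.
rewrite /perm_word -[n.+1]addn1 iotaD /= add1n addn1.
by rewrite perm_catC cat_cons perm_sym perm_catC /= perm_cons perm_sym perm_catC.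
Qed.

Lemma perm_word_uniq {n p} : perm_word n p -> uniq p.
Proof. by move/perm_uniq->; apply: iota_uniq. Qed.

Lemma perm_word_size {n p} : perm_word n p -> size p = n.
Proof. by move/perm_size->; rewrite size_iota. Qed.

Lemma mem_perm_word {n p} : perm_word n p -> forall a, (a \in p) = (0 < a <= n).
Proof. by move/perm_mem => H a; rewrite H mem_iota add1n ltnS. Qed.

Lemma perm_word_split {n p} : perm_word n.+1 p ->
  exists u v, [/\ p = u ++ n.+1 :: v, perm_word n (u ++ v),
                  n.+1 \notin u & n.+1 \notin v].
Proof.
move=> pw; have: n.+1 \in p by rewrite (mem_perm_word pw) /=.
move=> np; move: np pw => /splitPr[u v] pw; exists u, v; split=> //.
- by rewrite -perm_word_insert.
- by move: (perm_word_uniq pw); rewrite cat_uniq /= negb_or => /and3P[_ /andP[]].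
- by move: (perm_word_uniq pw); rewrite cat_uniq /= => /and3P[_ _ /andP[]].
Qed.

Lemma rem_insert (T : eqType) (m : T) (u v : seq T) :
  m \notin u -> rem m (u ++ m :: v) = u ++ v.
Proof.
elim: u => [|a u IH] /=; first by rewrite eqxx.
by rewrite inE eq_sym negb_or => /andP[/negPf-> /IH->].
Qed.

(** Each active letter occurs exactly once in [p]; this makes [act] the largest possible label. *)
Lemma count_Act d n p : perm_word n p -> count (mem (Act d p)) p = act d p.
Proof.
move=> pw; rewrite -size_filter; apply: perm_size; apply: uniq_perm.
- by rewrite filter_uniq // (perm_word_uniq pw).
- exact: active_upto_uniq.
move=> a; rewrite mem_filter /= andb_idr // => /mem_active_upto_range.
by rewrite (mem_perm_word pw) (perm_word_size pw).
Qed.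

(** * Difference permutations and labels under insertion *)

Lemma mem_Act_insert d n u v a : perm_word n (u ++ v) -> a <= n ->
  (a \in Act d (u ++ n.+1 :: v)) = (a \in Act d (u ++ v)).
Proof.
move=> pw an; have Es := perm_word_size pw.
rewrite /Act size_cat /= addnS -size_cat Es mem_active_upto_recr //.
by rewrite active_upto_insert.
Qed.

Lemma diff_perm_insert d n u v : n.+1 \notin u ->
  diff_perm d n.+1 (u ++ n.+1 :: v) =
  diff_perm d n (u ++ v) && ends_in (mem (Act d (u ++ v))) u.
Proof.
move=> nu; rewrite /diff_perm perm_word_insert.
case: (boolP (perm_word n (u ++ v))) => //= pw.
have lt a : a \in u ++ v -> a <= n by rewrite (mem_perm_word pw) => /andP[].
rewrite !all_Ascbot.
pose A : pred nat := mem (Act d (u ++ v)).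
rewrite -[ends_in _ u]/(ends_in A u).
(* An ascent bottom of the longer word is at most [n], so its activity can be tested in [u ++ v]. *)
rewrite (@eq_in_sorted _ [pred x | x \in u ++ n.+1 :: v] _
           (fun a b => (a < b) ==> A a)); last first.
- by apply/allP.
- move=> a b Ha; rewrite -[b \in _]/(b \in u ++ n.+1 :: v) mem_cat inE => Hb.
  case: ltnP => //= ab; apply: (mem_Act_insert _ pw).
  have : b <= n.+1; last by lia.
  by case/or3P: Hb => [H|/eqP->//|H]; apply/leqW/lt; rewrite mem_cat H ?orbT.
set e := fun a b => _.
rewrite -[sorted _ (u ++ v)]/(sorted e (u ++ v)).
(* The pair formed by [n.+1] and the next letter is a descent and imposes nothing. *)
have env : sorted e (n.+1 :: v) = sorted e v.
  case Ev: v => [|b v'] //=.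
  by rewrite {1}/e ltnNge leqW //=; apply: lt; rewrite Ev mem_cat inE eqxx orbT.
case/lastP: u nu pw lt @A @e env => [|u a] nu pw lt A e env.
  by rewrite /= -[path _ _ _]/(sorted e (_ :: v)) env andbT.
rewrite /ends_in /nilp size_rcons /= last_rcons.
have ea : e a n.+1 = A a.
  rewrite /e ltnS lt //; by rewrite mem_cat mem_rcons inE eqxx.
have cat w : sorted e (rcons u a ++ w) = sorted e (rcons u a) && path e a w.
  by case: (u) => [|b u'] //=; rewrite cat_path last_rcons.
have En : path e a (n.+1 :: v) = A a && sorted e v by rewrite /= ea -env.
rewrite !cat En.
rewrite -!andbA; congr (_ && _); rewrite andbC.
(* The insertion breaks the pair of [a] and the head of [v]; once [a] is active, that pair imposes
   nothing. *)
case Aa: (A a); rewrite ?andbF //= !andbT.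
by case: (v) => //= b v'; rewrite {2}/e Aa implybT.
Qed.

Lemma diff_perm_split d n p : diff_perm d n.+1 p ->
  exists u v, [/\ p = u ++ n.+1 :: v, n.+1 \notin u, diff_perm d n (u ++ v)
                & ends_in (mem (Act d (u ++ v))) u].
Proof.
move=> dp; have /andP[pw _] := dp; have [u [v [Ep _ nu _]]] := perm_word_split pw.
by exists u, v; move: dp; rewrite Ep diff_perm_insert // => /andP[].
Qed.

(** The last letter of [u] is active, so its rank among the active letters is the number of them in
    [u]; an empty [u] gives label 0. *)
Lemma insertion_labelE d (m : nat) (u v : seq nat) :
  uniq (u ++ v) -> m \notin u -> ends_in (mem (Act d (u ++ v))) u ->
  insertion_label d m (u ++ m :: v) (u ++ v) = count (mem (Act d (u ++ v))) u.
Proof.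
move=> us mu; rewrite /insertion_label index_cat (negPf mu) /= eqxx addn0.
case/lastP: u us mu => [|u a] //.
rewrite cat_uniq rcons_uniq => /andP[/andP[au _] _] _.
rewrite size_rcons /= nth_cat size_rcons ltnSn nth_rcons ltnn eqxx.
set A := Act d _.
rewrite /ends_in /nilp size_rcons last_rcons /= => aA.
rewrite filter_cat index_cat mem_filter aA mem_rcons mem_head /=.
rewrite filter_rcons aA -cats1 index_cat mem_filter (negPf au) andbF /= eqxx.
by rewrite addn0 -(cats1 u) count_cat /= aA size_filter addn0 addn1.
Qed.

Lemma phi_insert d n u v :
  n.+1 \notin u -> diff_perm d n (u ++ v) ->
  ends_in (mem (Act d (u ++ v))) u ->
  phi d (u ++ n.+1 :: v) =
  rcons (phi d (u ++ v)) (Posz (count (mem (Act d (u ++ v))) u)).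
Proof.
move=> nu /andP[pw _] Au; have Es := perm_word_size pw.
rewrite /phi size_cat /= addnS -size_cat Es.
(* The length 1 clause of [phi_rec] is treated apart: there [u] and [v] are empty and the label is
   0. *)
case: n nu pw Es => [|n] nu pw Es; first by case: u v Es {nu pw Au} => [|//] [].
rewrite [LHS]/= rem_insert // insertion_labelE //; exact: perm_word_uniq pw.
Qed.

(** * Activity of the inserted letter in terms of labels *)

Lemma index_between (T : eqType) (x y a : T) (u w v : seq T) :
  uniq (u ++ x :: w ++ y :: v) ->
  (index x (u ++ x :: w ++ y :: v) < index a (u ++ x :: w ++ y :: v)
   < index y (u ++ x :: w ++ y :: v)) = (a \in w).
Proof.
rewrite cat_uniq /= !mem_cat !inE cat_uniq /= negb_or has_cat /= !negb_or.
case/and5P=> _ /and3P[xu uw /andP[yu _]] /and3P[xw xy _] _.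
case/and3P=> /andP[yw _] _ _.
rewrite !index_cat (negPf xu) (negPf yu) /= eqxx (negPf xy).
rewrite !index_cat (negPf yw) /= eqxx.
case: (boolP (a \in u)) => au.
  have := index_mem a u; rewrite au => lt.
  suff -> : (a \in w) = false by lia.
  by apply: contraNF uw => aw; apply/hasP; exists a.
case: (eqVneq x a) => [<-|xa]; first by rewrite (negPf xw); lia.
have := index_mem a w; case: (a \in w) => lt; lia.
Qed.

(* The letters n+1 and n+2 have labels a, counting in [u1], and b, counting in
   [u]. If n+2 stands to the left of n+1, exactly a - b active letters below n+1
   lie between them; if it stands to the right, it is active and b > a. *)
Lemma inactive_insert d n u v u1 v1 :
  u ++ v = u1 ++ n.+1 :: v1 -> n.+2 \notin u -> n.+1 \notin u1 ->
  perm_word n.+1 (u ++ v) -> ends_in (mem (Act d (u ++ v))) u ->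
  inactive d (u ++ n.+2 :: v) (Act d (u ++ v)) n.+2 =
  (count (mem (Act d (u ++ v))) u + d <= count (mem (Act d (u1 ++ v1))) u1).
Proof.
move=> Es nu mu1 pw Au.
have us := perm_word_uniq pw.
have pw1 : perm_word n (u1 ++ v1) by rewrite -perm_word_insert -Es.
have pw2 : perm_word n.+2 (u ++ n.+2 :: v) by rewrite perm_word_insert.
set A := Act d (u ++ v) in Au *; set A1 := Act d (u1 ++ v1).
(* Letters of [u1] are at most [n], so their activity is the same before and after inserting
   [n.+1]. *)
have EA w : {subset w <= u1} -> count (mem A) w = count (mem A1) w.
  move=> sw; apply: eq_in_count => a /sw au1.
  have : a \in u1 ++ v1 by rewrite mem_cat au1.
  rewrite (mem_perm_word pw1) => /andP[_ an].
  by rewrite /= /A Es (mem_Act_insert d pw1 an).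
have: n.+1 \in u ++ v by rewrite (mem_perm_word pw) /=.
rewrite mem_cat; case: (boolP (n.+1 \in u)) => [mu _|mu /= mv].
  move: mu Au Es us nu => /splitPr[w1 w2] Au.
  rewrite -catA cat_cons cat_uniq /= negb_or => Es /and3P[_ /andP[mw1 _] _] nu.
  have [Ew _] := cat_cons_inj mw1 mu1 Es.
  (* The last letter of [u] is active and lies in this block, possibly being [n.+1] itself. *)
  have : 0 < count (mem A) (n.+1 :: w2).
    rewrite -has_count; apply/hasP; exists (last n.+1 w2); first exact: mem_last.
    by move: Au; rewrite /ends_in /nilp size_cat addnS last_cat.
  have E1 : count (mem A) w1 = count (mem A1) u1 by rewrite EA Ew.
  rewrite count_cat E1 => lt; rewrite [RHS]leqNgt (_ : _ < _ = true); last first.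
    by rewrite -addnA -[ltnLHS]addn0 ltn_add2l addn_gt0 lt.
  have mi : index n.+1 (w1 ++ n.+1 :: w2) < size (w1 ++ n.+1 :: w2).
    by rewrite index_mem mem_cat mem_head orbT.
  rewrite /inactive /= [X in X < _]index_cat (negPf nu) /= eqxx addn0.
  rewrite [X in _ < X]index_cat mem_cat mem_head orbT.
  by rewrite ltnNge (ltnW mi).
move: mv Es us pw2 => /splitPr[w v2] Es us pw2.
have muw : n.+1 \notin u ++ w.
  by move: us; rewrite catA cat_uniq /= negb_or => /and3P[_ /andP[]].
have [Eu1 _] := cat_cons_inj muw mu1 (etrans (esym (catA _ _ _)) Es).
rewrite /inactive /=.
have Ix : index n.+2 (u ++ n.+2 :: w ++ n.+1 :: v2) <
          index n.+1 (u ++ n.+2 :: w ++ n.+1 :: v2).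
  move: muw; rewrite mem_cat negb_or !index_cat (negPf nu).
  move=> /andP[/negPf-> /negPf mw].
  by rewrite /= eqxx index_cat mw; case: eqP => /=; lia.
rewrite Ix /= -Eu1 count_cat (EA u) -?Eu1; last by move=> a au; rewrite mem_cat au.
rewrite leq_add2l -(EA w) -?Eu1; last by move=> a aw; rewrite mem_cat aw orbT.
congr (_ <= _); rewrite -!size_filter; apply/perm_size/uniq_perm.
- by rewrite filter_uniq // active_upto_uniq.
- by apply: filter_uniq; move: us; rewrite catA !cat_uniq => /andP[/and3P[]].
move=> a; rewrite !mem_filter /= index_between ?(perm_word_uniq pw2) //.
rewrite [RHS]andbC; case: (boolP (a \in A)) => aA; rewrite ?andbF // !andbT.
rewrite andb_idl // => aw.
move/mem_active_upto_range: aA; rewrite (perm_word_size pw) ltnS.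
suff : a != n.+1 by lia.
by apply: contraNneq muw => <-; rewrite mem_cat aw orbT.
Qed.

(** * Appending one entry to a d-ascent sequence *)

Lemma dasc_rcons d y x : 0 < size y ->
  dasc d (rcons y x) = dasc d y + (last 0%R y - d%:Z < x)%R.
Proof.
case: y => [|a y] // _.
have Es : (size (rcons (a :: y) x)).-1 = size y + 1 by rewrite size_rcons addn1.
rewrite /dasc Es iotaD count_cat /= addn0; congr (_ + _).
  apply: eq_in_count => i; rewrite mem_iota add0n /= => lt.
  by rewrite /is_dascent -rcons_cons !nth_rcons /= !ltnS lt ltnW.
rewrite /is_dascent add0n -rcons_cons !nth_rcons /= ltnSn ltnn eqxx.
by rewrite -last_nth.
Qed.

Lemma dascent_seq_rcons d n y x : size y = n.+1 ->
  dascent_seq d n.+2 (rcons y x) =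
  dascent_seq d n.+1 y && (0 <= x <= (dasc d y)%:Z + 1)%R.
Proof.
move=> Es; rewrite /dascent_seq size_rcons Es !eqxx !andTb.
rewrite nth_rcons Es -andbA; congr (_ && _).
have -> : n.+2.-1 = n + 1 by rewrite addn1.
rewrite iotaD all_cat add1n all_seq1; congr (_ && _).
  apply: eq_in_all => i; rewrite mem_iota => lt.
  by rewrite nth_rcons Es ifT -?cats1 ?takel_cat ?Es; lia.
by rewrite nth_rcons Es ltnn eqxx -cats1 take_size_cat.
Qed.

Lemma act_insert d n u v : perm_word n.+1 (u ++ v) ->
  act d (u ++ n.+2 :: v) =
  act d (u ++ v) + ~~ inactive d (u ++ n.+2 :: v) (Act d (u ++ v)) n.+2.
Proof.
move=> pw; have Es := perm_word_size pw.
rewrite /act /Act size_cat /= addnS -size_cat Es.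
rewrite active_uptoSS active_upto_insert //.
by case: ifP; rewrite ?size_rcons ?addn0 ?addn1.
Qed.

(** * The bijection, by induction on the length *)

Lemma phi_spec d n p : diff_perm d n.+1 p ->
  dascent_seq d n.+1 (phi d p) /\ act d p = dasc d (phi d p) + 1.
Proof.
elim: n p => [|n IH] p dp; have [u [v [-> nu ds Au]]] := diff_perm_split dp.
  have /andP[pw _] := ds; have /eqP := perm_word_size pw.
  by rewrite size_cat addn_eq0 => /andP[/nilP-> /nilP->].
have /andP[pw _] := ds.
have [dsq Ea] := IH _ ds; have /and3P[/eqP Es _ _] := dsq.
rewrite phi_insert // dascent_seq_rcons // dsq dasc_rcons ?Es //; split.
  (* The new label is at most [act] of the shorter word, which [Ea] turns into [dasc + 1]; hence the
     joint induction on both claims. *)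
  have := count_Act d pw; rewrite Ea count_cat /=; lia.
rewrite act_insert // Ea addnAC; congr (_ + _ + _).
(* Splitting at [n.+1] exhibits the last entry of the shorter sequence as the label of [n.+1], to be
   compared with that of [n.+2]. *)
have [u1 [v1 [E1 mu1 ds1 Au1]]] := diff_perm_split ds.
rewrite (inactive_insert E1) // E1 phi_insert // last_rcons -E1 -ltnNge.
by rewrite Num.Theory.ltrBlDr -PoszD ltz_nat.
Qed.

(** The initial entries determine the shorter word by induction, and the last label then determines
    the slot. *)
Lemma phi_inj d n p q : diff_perm d n p -> diff_perm d n q ->
  phi d p = phi d q -> p = q.
Proof.
elim: n p q => [|n IH] p q.
  by move=> /andP[/perm_word_size/size0nil-> _] /andP[/perm_word_size/size0nil->].
move=> dp dq; have [u [v [-> nu ds Au]]] := diff_perm_split dp.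
have [u' [v' [-> nu' ds' Au']]] := diff_perm_split dq.
rewrite !phi_insert // => /rcons_inj[E Ec].
have Es := IH _ _ ds ds' E.
by rewrite -Es in Au' Ec; have [-> ->] := ends_in_eq_count Au Au' Es Ec.
Qed.

Lemma phi_surj d n x : dascent_seq d n.+1 x ->
  exists2 p, diff_perm d n.+1 p & phi d p = x.
Proof.
elim: n x => [|n IH] x.
  case: x => [|a [|b x]] //; rewrite /dascent_seq /= andbT => /eqP->.
  by exists [:: 1].
case/lastP: x => [|y a] // H.
have Es : size y = n.+1 by move: H => /andP[]; rewrite size_rcons eqSS => /eqP.
move: H; rewrite dascent_seq_rcons // => /andP[/IH[s ds <-] /andP[a0 le]].
have [_ Ea] := phi_spec ds; have /andP[pw _] := ds.
case: a a0 le => // k _ le.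
(* A slot with label [k] exists because [k] is at most [dasc + 1], the number of active letters of
   [s]. *)
have [|u [v [E Ek Au]]] := @ends_in_exists (mem (Act d s)) s k.
  by rewrite (count_Act d pw) Ea; lia.
have nu : n.+2 \notin u.
  apply/negP => H; have : n.+2 \in s by rewrite E mem_cat H.
  by rewrite (mem_perm_word pw); lia.
rewrite E in ds Au Ek *; exists (u ++ n.+2 :: v).
  by rewrite diff_perm_insert // ds.
by rewrite phi_insert // Ek.
Qed.

Theorem theorem2p7 (d n : nat) (hn : 1 <= n) :
  [/\ (forall p : seq nat, diff_perm d n p -> dascent_seq d n (phi d p)),
      (forall p q : seq nat, diff_perm d n p -> diff_perm d n q ->
         phi d p = phi d q -> p = q) &
      (forall x : seq int, dascent_seq d n x ->
         exists2 p : seq nat, diff_perm d n p & phi d p = x)]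
  /\ (forall p : seq nat, diff_perm d n p -> act d p = dasc d (phi d p) + 1).
Proof.
case: n hn => // n _; split; [split|].
- by move=> p /phi_spec[].
- exact: phi_inj.
- exact: phi_surj.
- by move=> p /phi_spec[].
Qed.
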